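(* Let $F$ be either $\mathbb{C}$ or an algebraically closed field of positive characteristic, let $n,k\ge 1$, let $A=F[\sigma_1,\sigma_1^{-1},\ldots,\sigma_n,\sigma_n^{-1}]$, and let $P$ be an $A$-submodule of $A^k$, defining the system $\ker_{\mathcal{F}_{\mathbb{L}}}(P)$ on $\mathbb{L}=\mathbb{Z}^n$. (1) If $P$ is a constant submodule (i.e. $P\in\mathcal{M}(F)$), then $\ker_{\mathcal{F}_{\mathbb{L}}}(P)$ can be reconstructed from its contraction to any sublattice of $\mathbb{L}$, in particular from its contraction to the zero sublattice $0\subset\mathbb{L}$. (2) If $P$ is not a constant submodule, then there is a unique coarsest sublattice $\mathbb{S}$ of $\mathbb{L}$, and it has rank at least $1$, such that $\ker_{\mathcal{F}_{\mathbb{L}}}(P)$ can be reconstructed from its contraction $\ker_{\mathcal{F}_{\mathbb{S}}}(P\cap A_S^k)$ to $\mathbb{S}$, but not from its contraction to any coarser sublattice; that is, there is exactly one sublattice $\mathbb{S}\subset\mathbb{L}$ such that $\ker_{\mathcal{F}_{\mathbb{L}}}(P)$ can be reconstructed from its contraction to $\mathbb{S}$ but cannot be reconstructed from its contraction to any sublattice $\mathbb{S}'\subsetneq\mathbb{S}$, and the rank of this $\mathbb{S}$ is at least $1$.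
   Context: $\mathbb{L}=\mathbb{Z}^n$; for $x\in\mathbb{Z}^n$ write $\sigma^x=\sigma_1^{x_1}\cdots\sigma_n^{x_n}\in A$. $\mathcal{F}_{\mathbb{L}}$ is the set of all functions $\mathbb{Z}^n\to F$, an $A$-module via $(\sigma^y f)(x)=f(x+y)$. For an $A$-submodule $P\subset A^k$, $\ker_{\mathcal{F}_{\mathbb{L}}}(P)=\{(f_1,\ldots,f_k)\in\mathcal{F}_{\mathbb{L}}^k : \sum_j p_jf_j=0 \text{ for all } (p_1,\ldots,p_k)\in P\}$ is the system defined by $P$. A sublattice $\mathbb{S}$ is any subgroup of $\mathbb{L}$ (of any rank $0\le r\le n$). $\mathbb{S}$ is coarser than $\mathbb{S}'$ if $\mathbb{S}\subset\mathbb{S}'$. $A_S\subset A$ is the $F$-subalgebra spanned by the monomials $\sigma^x$, $x\in\mathbb{S}$ (so $A_S=F$ if $\mathbb{S}=0$). $\mathcal{F}_{\mathbb{S}}$ is the $A_S$-module (by shifts) of all functions $\mathbb{S}\to F$, and for an $A_S$-submodule $Q\subset A_S^k$ the system $\ker_{\mathcal{F}_{\mathbb{S}}}(Q)\subset\mathcal{F}_{\mathbb{S}}^k$ is defined in the same way. The contraction of $P$ to $A_S^k$ is $P^c=P\cap A_S^k$, and $\ker_{\mathcal{F}_{\mathbb{S}}}(P^c)$ is the contraction of the system to $\mathbb{S}$. For an $A_S$-submodule $Q\subset A_S^k$, its extension $Q^e$ is the $A$-submodule of $A^k$ generated by $Q$, and $\ker_{\mathcal{F}_{\mathbb{L}}}(Q^e)$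 is the extension of $\ker_{\mathcal{F}_{\mathbb{S}}}(Q)$ to $\mathbb{L}$. The system $\ker_{\mathcal{F}_{\mathbb{L}}}(P)$ can be reconstructed from its contraction to $\mathbb{S}$ if it is equal to the extension of its contraction to $\mathbb{S}$; equivalently $P=(P\cap A_S^k)^e$. An $A$-submodule $P$ of $A^k$ is constant if it has a set of generators in $F^k$; $\mathcal{M}(F)$ is the set of constant submodules of $A^k$. *)

(* Defs.v *)
From HB Require Import structures.
From mathcomp Require Import all_boot all_order all_algebra.
From mathcomp Require Import finmap boolp classical_sets reals complex.
From mathcomp.multinomials Require Import monalg.

Set Implicit Arguments.
Unset Strict Implicit.
Unset Printing Implicit Defensive.

Import GRing.Theory.

Local Open Scope ring_scope.
Local Open Scope classical_set_scope.
Local Open Scope complex_scope.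

(* Any two instances of realType are isomorphic ordered fields, so R[i] is C
   up to isomorphism for whichever R is chosen. *)
Definition is_complex_field (F : fieldType) : Prop :=
  exists (R : realType) (h : {rmorphism F -> R[i]}), bijective h.

Definition has_pos_char (F : fieldType) : Prop :=
  exists p : nat, p \in [pchar F].

(* The Laurent polynomial ring F[s_1, s_1^-1, ..., s_n, s_n^-1], as the group
   algebra of Z^n: p@_x is the coefficient of s^x.  The product cannot be taken
   from monalg, whose monomType excludes monomials with inverses. *)
Definition laurent (n : nat) (F : fieldType) : Type :=
  {malg F['rV[int]_n]}.

HB.instance Definition _ n F := GRing.Lmodule.on (laurent n F).

Section LaurentRing.
Context (n : nat) (F : fieldType).
Implicit Types p q r : laurent n F.

Definition lmonom (x : 'rV[int]_n) : laurent n F := << 1 *g x >>.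

Definition lmul p q : laurent n F :=
  \sum_(x <- msupp p) \sum_(y <- msupp q) << p@_x * q@_y *g x + y >>.

Lemma lmulw (d1 d2 : {fset 'rV[int]_n}) p q :
  (msupp p `<=` d1)%fset -> (msupp q `<=` d2)%fset ->
  lmul p q = \sum_(x <- d1) \sum_(y <- d2) << p@_x * q@_y *g x + y >>.
Proof.
move=> le1 le2; rewrite /lmul (big_fset_incl _ le1) /=.
  apply: eq_bigr => x _; apply: big_fset_incl => // y _ /mcoeff_outdom ->.
  by rewrite mulr0 monalgU0.
by move=> x _ /mcoeff_outdom px; rewrite big1 // => y _; rewrite px mul0r monalgU0.
Qed.

Lemma lmulC : commutative lmul.
Proof.
move=> p q; rewrite /lmul exchange_big /=; apply: eq_bigr => y _.
by apply: eq_bigr => x _; rewrite mulrC addrC.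
Qed.

Lemma lmulDl : left_distributive lmul +%R.
Proof.
move=> p q r; have sr := fsubset_refl (msupp r).
rewrite (lmulw (fsubsetUl (msupp p) (msupp q)) sr).
rewrite (lmulw (fsubsetUr (msupp p) (msupp q)) sr).
rewrite (lmulw (msuppD_le p q) sr) -big_split /=; apply: eq_bigr => x _.
rewrite -big_split /=; apply: eq_bigr => y _.
by rewrite mcoeffD mulrDl monalgUD.
Qed.

Lemma lmulDr : right_distributive lmul +%R.
Proof. by move=> p q r; rewrite lmulC lmulDl !(lmulC p). Qed.

Lemma lmul0 q : lmul 0 q = 0.
Proof. by rewrite /lmul msupp0 big_seq_fset0. Qed.

Lemma lmulr0 q : lmul q 0 = 0.
Proof. by rewrite lmulC lmul0. Qed.

Lemma lmulU (a b : F) (x y : 'rV[int]_n) :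
  lmul << a *g x >> << b *g y >> = << a * b *g x + y >>.
Proof. by rewrite (lmulw msuppU_le msuppU_le) !big_seq_fset1 !mcoeffUU. Qed.

Lemma lmul_suml I (s : seq I) (G : I -> laurent n F) q :
  lmul (\sum_(i <- s) G i) q = \sum_(i <- s) lmul (G i) q.
Proof. exact: (big_morph (lmul^~ q) (fun u v => lmulDl u v q) (lmul0 q)). Qed.

Lemma lmul_sumr I (s : seq I) (G : I -> laurent n F) q :
  lmul q (\sum_(i <- s) G i) = \sum_(i <- s) lmul q (G i).
Proof. exact: (big_morph (lmul q) (lmulDr q) (lmulr0 q)). Qed.

Lemma laurentE p : p = \sum_(x <- msupp p) (<< p@_x *g x >> : laurent n F).
Proof. exact: monalgE. Qed.

Lemma lmulA : associative lmul.
Proof.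
move=> p q r; rewrite (laurentE p) !lmul_suml; apply: eq_bigr => x _.
rewrite (laurentE q) lmul_sumr !lmul_suml lmul_sumr; apply: eq_bigr => y _.
rewrite (laurentE r) !lmul_sumr; apply: eq_bigr => z _.
by rewrite !lmulU mulrA addrA.
Qed.

Lemma lmul1 : left_id (lmonom 0) lmul.
Proof.
move=> p; rewrite (laurentE p) lmul_sumr; apply: eq_bigr => x _.
by rewrite lmulU mul1r add0r.
Qed.

Lemma lmonom0_neq0 : lmonom 0 != 0.
Proof. by rewrite monalgU_eq0 oner_eq0. Qed.

HB.instance Definition _ := GRing.Zmodule_isComNzRing.Build (laurent n F)
  lmulA lmulC lmul1 lmulDl lmonom0_neq0.

Lemma lscalerAl (c : F) p q : c *: (p * q) = c *: p * q.
Proof.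
have ZU (d a : F) (x : 'rV[int]_n) : d *: << a *g x >> = << d * a *g x >>.
  by apply/malgP => y; rewrite mcoeffZ !mcoeffU mulrnAr.
rewrite -[p * q]/(lmul p q) -[_ * q]/(lmul (c *: p) q).
rewrite (lmulw (msuppZ_le c p) (fsubset_refl _)) scaler_sumr.
apply: eq_bigr => x _; rewrite scaler_sumr; apply: eq_bigr => y _.
by rewrite ZU mcoeffZ mulrA.
Qed.

HB.instance Definition _ :=
  GRing.Lmodule_isLalgebra.Build F (laurent n F) lscalerAl.
HB.instance Definition _ :=
  GRing.Lalgebra_isComAlgebra.Build F (laurent n F).

End LaurentRing.

Section Systems.
Context (n k : nat) (F : fieldType).

Local Notation L := 'rV[int]_n.
Local Notation A := (laurent n F).

Implicit Types (S : set L) (P Q : set 'rV[A]_k).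

Definition is_sublattice S : Prop := zmod_closed [in S].

(* The largest number of Z-linearly independent elements of S (the rows of B);
   n + 1 elements of Z^n are never independent, so r <= n loses nothing. *)
Definition lattice_rank S : nat :=
  \max_(r < n.+1 | `[< exists B : 'M[int]_(r, n),
      (forall i, S (row i B)) /\
      (forall u : 'rV[int]_r, u *m B = 0 -> u = 0) >]) r.

Definition is_submodule P : Prop := submod_closed [in P].

Definition generated (G : set 'rV[A]_k) : set 'rV[A]_k :=
  smallest is_submodule G.

Definition is_constant P : Prop :=
  exists G : set 'rV[F]_k, P = generated (map_mx (in_alg A) @` G).

Definition subalg_of S : set A :=
  [set p | exists (s : seq L) (c : L -> F),
     (forall x, x \in s -> S x) /\ p = \sum_(x <- s) c x *: lmonom F x].

Definition free_over S : set 'rV[A]_k :=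
  [set v | forall j, subalg_of S (v 0 j)].

Definition is_submodule_over S Q : Prop :=
  [/\ Q `<=` free_over S, Q 0 &
      forall (a : A) (u v : 'rV[A]_k),
        subalg_of S a -> Q u -> Q v -> Q (a *: u + v)].

Definition laction (p : A) (f : L -> F) : L -> F :=
  fun x => \sum_(y <- msupp p) p@_y * f (x + y).

Definition extend0 S (f : {x | S x} -> F) : L -> F :=
  fun x => if pselect (S x) is left Sx then f (exist S x Sx) else 0.

(* Meant for p in A_S only: then x + y stays in S for x in S and y in the
   support of p, and the values of extend0 f off S play no role. *)
Definition laction_on S (p : A) (f : {x | S x} -> F) : {x | S x} -> F :=
  fun x => laction p (extend0 f) (sval x).

Definition system P : set ('I_k -> L -> F) :=
  [set f | forall p, P p -> forall x, \sum_j laction (p 0 j) (f j) x = 0].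

Definition system_on S Q : set ('I_k -> {x | S x} -> F) :=
  [set f | forall q, Q q ->
     forall x, \sum_j laction_on (q 0 j) (f j) x = 0].
Arguments system_on : clear implicits.

Definition contraction S P : set 'rV[A]_k := P `&` free_over S.

(* C is the extension to L of the system B on S; C depends on B alone, not on
   the module Q chosen to define B. *)
Definition is_extension S (B : set ('I_k -> {x | S x} -> F))
    (C : set ('I_k -> L -> F)) : Prop :=
  exists Q, [/\ is_submodule_over S Q, B = system_on S Q &
                C = system (generated Q)].

Definition reconstructible P S : Prop :=
  is_extension (system_on S (contraction S P)) (system P).

Definition coarsest_reconstructible P S : Prop :=
  [/\ is_sublattice S, reconstructible P S &
      forall S', is_sublattice S' -> S' `<` S -> ~ reconstructible P S'].

End Systems.

Arguments system_on {n k F} S Q.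

(* Main.v *)
Require Import Defs.
From mathcomp Require Import all_boot all_order all_algebra.
From mathcomp Require Import finmap boolp classical_sets.
From mathcomp.multinomials Require Import monalg.

(** By linear duality a submodule is determined by its system: a vector outside
    [P] is separated from [P] by an [F]-linear functional on [A^k], and such a
    functional is a [k]-tuple of functions on [Z^n].  Hence the system of [P] is
    reconstructible from [S] iff [P] is generated by [P] intersected with
    [A_S^k].  Since monomials are units, this holds iff [P] is homogeneous for
    the grading of [A^k] by [Z^n / S].  Homogeneity passes to arbitrary
    intersections of sublattices, because supports are finite, so there is a
    least reconstructing sublattice; if it were zero, [P] would be constant. *)

Set Implicit Arguments.
Unset Strict Implicit.
Unset Printing Implicit Defensive.

Import GRing.Theory.

Local Open Scope ring_scope.
Local Open Scope classical_set_scope.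

(** * Separating a vector from a subspace by a linear functional *)

Section SeparatingFunctional.
Context (F : fieldType) (V : lmodType F).

Definition linear_set (W : set V) : Prop :=
  forall (c : F) (u w : V), W u -> W w -> W (c *: u + w).

Lemma linear_setZ (W : set V) (c : F) (u : V) :
  linear_set W -> W u -> W (c *: u).
Proof.
move=> linW Wu; have W0 : W 0 by have := linW (-1) u u Wu Wu; rewrite scaleN1r addNr.
by have := linW c u 0 Wu W0; rewrite addr0.
Qed.

(** Zorn's lemma gives a maximal subspace avoiding [v]. Adjoining any [u] outside it must capture
    [v], so it is a complement of the line [F v]. *)
Lemma maximal_avoiding (P : set V) (v : V) :
  linear_set P -> P 0 -> ~ P v ->
  exists W : set V, [/\ linear_set W, P `<=` W, ~ W v &
    forall u, exists c, W (u - c *: v)].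
Proof.
move=> linP P0 Pv.
(* Stability under translation by [P], rather than [P `<=` W], so that the
   union of the empty chain qualifies. *)
pose D (W : set V) := [/\ linear_set W, (forall w p, W w -> P p -> W (w + p)) & ~ W v].
have [W [[linW WP Wv] maxW]] : exists W, D W /\ forall B, W `<` B -> ~ D B.
  apply: (@Zorn_bigcup _ D) => C CD totC; split.
  - move=> c u w [X CX Xu] [Y CY Yw].
    case: (totC X Y CX CY) => sub; [exists Y|exists X] => //.
      by have [+ _ _] := CD _ CY; apply=> //; exact: sub.
    by have [+ _ _] := CD _ CX; apply=> //; exact: sub.
  - by move=> w p [X CX Xw] Pp; exists X => //; have [_ + _] := CD _ CX; apply.
  - by move=> [X CX Xv]; have [_ _ +] := CD _ CX; apply.
have DP : D P.
  by split=> // w p Pw Pp; have := linP 1 w p Pw Pp; rewrite scale1r.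
(* The empty set also satisfies [D], but it is not maximal, since [P] contains [0]. *)
have [w0 Ww0] : exists w, W w.
  apply: contrapT => W0; apply: (maxW P) => //; split=> [w Ww|/(_ 0 P0) W0'].
    by case: W0; exists w.
  by apply: W0; exists 0.
have W0 : W 0 by rewrite -(scale0r w0); exact: linear_setZ.
exists W; split=> // [p Pp|u]; first by rewrite -[p]add0r; exact: WP.
have [Wu|nWu] := pselect (W u); first by exists 0; rewrite scale0r subr0.
(* The span of [W] and [u] is strictly larger than [W], so it cannot avoid [v]. *)
pose W' := [set x | exists w c, W w /\ x = w + c *: u].
have [w [c [Ww vE]]] : W' v.
  apply: contrapT => W'v; apply: (maxW W').
    split=> [w Ww|sub]; first by exists w, 0; rewrite scale0r addr0.
    by apply: nWu; apply: sub; exists 0, 1; rewrite scale1r add0r.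
  split=> // [d x y [w [c [Ww ->]]] [w' [c' [Ww' ->]]]|x p [w [c [Ww ->]]] Pp].
    exists (d *: w + w'), (d * c + c'); split; first exact: linW.
    by rewrite scalerDr scalerDl scalerA addrACA.
  by exists (w + p), c; split; [exact: WP | rewrite addrAC].
have c0 : c != 0.
  by apply/eqP => c0; apply: Wv; rewrite vE c0 scale0r addr0.
(* Solving [v = w + c *: u] for [u] gives [u - c^-1 *: v = - c^-1 *: w]. *)
exists c^-1; rewrite vE scalerDr scalerA mulVf // scale1r opprD addrCA subrr addr0.
by rewrite -scaleNr; exact: linear_setZ.
Qed.

(** The functional is the coordinate along [v] in the decomposition of [V] as [W] plus the line
    [F v]. *)
Lemma separating_functional (P : set V) (v : V) :
  linear_set P -> P 0 -> ~ P v ->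
  exists phi : V -> F,
    [/\ forall c u w, phi (c *: u + w) = c * phi u + phi w,
        forall u, P u -> phi u = 0 & phi v != 0].
Proof.
move=> linP P0 Pv; have [W [linW PW Wv /choice[phi Wphi]]] := maximal_avoiding linP P0 Pv.
(* Two different coordinates of [u] would put a nonzero multiple of [v] into [W]. This uniqueness
   makes [phi] linear. *)
have phiE u c : W (u - c *: v) -> phi u = c.
  move=> Wc; apply/eqP; rewrite -subr_eq0; apply/eqP; apply: contrapT => /eqP d0.
  apply: Wv; have := linear_setZ (phi u - c)^-1 linW (linW (-1) _ _ (Wphi u) Wc).
  rewrite scaleN1r opprB addrA addrNK.
  by rewrite -scalerBl scalerA mulVf // scale1r.
exists phi; split=> [c u w|u Pu|].
- apply: phiE; have := linW c _ _ (Wphi u) (Wphi w).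
  by rewrite scalerBr scalerA scalerDl opprD addrACA.
- by apply: phiE; rewrite scale0r subr0; exact: PW.
- by rewrite (phiE v 1) ?oner_neq0 // scale1r subrr; exact: PW.
Qed.

End SeparatingFunctional.

(** * Coefficients of Laurent polynomials and their action on functions *)

Section Laurent.
Context (n : nat) (F : fieldType).
Local Notation L := 'rV[int]_n.
Local Notation A := (laurent n F).
Implicit Types (p q : A) (x y z : L) (d : set L) (f : L -> F).

Lemma laurent_eq p q : (forall x, p@_x = q@_x) -> p = q.
Proof. by move=> /malgP. Qed.

Lemma lmcoeffD p q x : (p + q)@_x = p@_x + q@_x.
Proof. exact: mcoeffD. Qed.

Lemma lmcoeffZ (c : F) p x : (c *: p)@_x = c * p@_x.
Proof. exact: mcoeffZ. Qed.

Lemma mcoeff_lmonom x y : (lmonom F x)@_y = (x == y)%:R.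
Proof. exact: mcoeffU. Qed.

Lemma laurentZE p : p = \sum_(x <- msupp p) p@_x *: lmonom F x.
Proof.
rewrite {1}(laurentE p); apply: eq_bigr => x _.
by apply: laurent_eq => y; rewrite mcoeffU lmcoeffZ mcoeff_lmonom mulr_natr.
Qed.

Lemma laurent_ind (K : A -> Prop) :
  K 0 -> (forall c x p, K p -> K (c *: lmonom F x + p)) -> forall p, K p.
Proof.
by move=> K0 KD p; rewrite (laurentZE p); elim/big_rec: _ => // x q _; exact: KD.
Qed.

Lemma lmonomM x y : lmonom F x * lmonom F y = lmonom F (x + y).
Proof. by rewrite -[LHS]/(lmul _ _) lmulU mulr1. Qed.

Lemma mcoeff_lmonomM x p y : (lmonom F x * p)@_y = p@_(y - x).
Proof.
move: p y; apply: laurent_ind => [|c z p IH] y; first by rewrite mulr0 !mcoeff0.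
rewrite mulrDr -scalerAr lmonomM !lmcoeffD IH !lmcoeffZ !mcoeff_lmonom.
by rewrite [z == _]eq_sym subr_eq (addrC z) [y == _]eq_sym.
Qed.

Lemma mcoeff_in_alg (c : F) x : (in_alg A c)@_x = c *+ (x == 0).
Proof. by rewrite in_algE lmcoeffZ mcoeff_lmonom mulr_natr eq_sym. Qed.

(** The lock leaves [mcoeff_restr] as the way to reason about the truncation. *)
Definition restr d : A -> A :=
  locked (fun p => [malg x in msupp p => if `[< d x >] then p@_x else 0]).

Lemma mcoeff_restr d p x : (restr d p)@_x = if `[< d x >] then p@_x else 0.
Proof. by rewrite /restr -lock mcoeffE; case: msuppP => // _; case: ifP. Qed.

Lemma subalg_ofP (S : set L) p :
  subalg_of S p <-> (forall x, p@_x != 0 -> S x).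
Proof.
split=> [[s [c [sS ->]]] x|Sp].
  move=> /eqP px; apply: sS; apply: contrapT => /negP xs; apply: px.
  rewrite (raddf_sum (mcoeff x)) big1_seq // => y /andP[_ ys] /=.
  rewrite lmcoeffZ mcoeff_lmonom; case: eqP => [yx|]; last by rewrite mulr0.
  by move: xs; rewrite -yx ys.
exists (msupp p), (fun x => p@_x); split; last exact: laurentZE.
by move=> x; rewrite -mcoeff_neq0; exact: Sp.
Qed.

Lemma laction_sub (D : {fset L}) p f x : (msupp p `<=` D)%fset ->
  laction p f x = \sum_(y <- D) p@_y * f (x + y).
Proof.
move=> le; rewrite /laction (big_fset_incl _ le) // => y _ /mcoeff_outdom ->.
by rewrite mul0r.
Qed.

Lemma laction0 f x : laction (0 : A) f x = 0.
Proof. by rewrite /laction msupp0 big_seq_fset0. Qed.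

Lemma laction_linear c p q f x :
  laction (c *: p + q) f x = c * laction p f x + laction q f x.
Proof.
have sp : (msupp p `<=` msupp p `|` msupp q)%fset by exact: fsubsetUl.
rewrite (laction_sub _ _ sp) (laction_sub _ _ (fsubsetUr (msupp p) (msupp q))).
rewrite (@laction_sub (msupp p `|` msupp q)%fset).
  rewrite mulr_sumr -big_split /=; apply: eq_bigr => y _.
  by rewrite lmcoeffD lmcoeffZ mulrDl mulrA.
apply: (fsubset_trans (msuppD_le _ _)); apply: fsetSU; exact: msuppZ_le.
Qed.

Lemma laction_lmonom y f x : laction (lmonom F y) f x = f (x + y).
Proof. by rewrite (laction_sub _ _ msuppU_le) big_seq_fset1 mcoeffUU mul1r. Qed.

Lemma laction_lmonomM y p f x :
  laction (lmonom F y * p) f x = laction p f (x + y).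
Proof.
move: p; apply: laurent_ind => [|c z p IH]; first by rewrite mulr0 !laction0.
by rewrite mulrDr -scalerAr lmonomM !laction_linear IH !laction_lmonom addrA.
Qed.

End Laurent.

(** * Submodules of [A^k] and generation *)

Section Submodules.
Context (n k : nat) (F : fieldType).
Local Notation L := 'rV[int]_n.
Local Notation A := (laurent n F).
Implicit Types (P Q : set 'rV[A]_k) (S T : set L) (u v w : 'rV[A]_k).

Lemma is_submoduleP P :
  is_submodule P <-> P 0 /\ forall a u v, P u -> P v -> P (a *: u + v).
Proof.
split=> [[P0 PD]|[P0 PD]].
  split=> [|a u v Pu Pv]; first by move: P0; rewrite inE.
  by apply/set_mem; apply: PD; exact/mem_set.
by split=> [|a u v /set_mem Pu /set_mem Pv]; apply/mem_set => //; exact: PD.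
Qed.

Lemma submodule0 P : is_submodule P -> P 0.
Proof. by case/is_submoduleP. Qed.

Lemma submoduleZ P a u : is_submodule P -> P u -> P (a *: u).
Proof. by move=> /is_submoduleP[P0 PD] Pu; rewrite -[_ *: _]addr0; exact: PD. Qed.

Lemma submoduleD P u v : is_submodule P -> P u -> P v -> P (u + v).
Proof. by move=> /is_submoduleP[P0 PD] Pu Pv; rewrite -[u]scale1r; exact: PD. Qed.

Lemma submoduleB P u v : is_submodule P -> P u -> P v -> P (u - v).
Proof.
move=> PM Pu Pv; apply: submoduleD => //; rewrite -scaleN1r; exact: submoduleZ.
Qed.

Lemma submodule_monomial P :
  P 0 -> (forall u v, P u -> P v -> P (u + v)) ->
  (forall c x u, P u -> P ((c *: lmonom F x) *: u)) -> is_submodule P.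
Proof.
move=> P0 PD PZ; apply/is_submoduleP; split=> // a u v Pu Pv; apply: (PD); last exact: Pv.
move: a; apply: laurent_ind => [|c x p IH]; first by rewrite scale0r.
by rewrite scalerDl; exact: (PD _ _ (PZ _ _ _ Pu) IH).
Qed.

Lemma generated_submodule P : is_submodule (generated P).
Proof.
apply/is_submoduleP; split=> [M [MM _]|a u v Pu Pv M [MM MP]].
  exact: submodule0.
have /is_submoduleP[_ MD] := MM.
by apply: MD; [exact: Pu | exact: Pv].
Qed.

Lemma generated_sub P : P `<=` generated P.
Proof. by move=> u Pu M [_]; exact. Qed.

Lemma generated_min P Q : is_submodule Q -> P `<=` Q -> generated P `<=` Q.
Proof. by move=> QM PQ u; apply. Qed.

(** * Duality between submodules and systems *)

Lemma system_generated P : system (generated P) = system P.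
Proof.
apply/seteqP; split=> f fP p; first by move=> Pp; apply: fP; exact: generated_sub.
(* The vectors that annihilate [f] at all points form a submodule, because multiplying by a monomial
   only translates the point. *)
pose K := [set q : 'rV[A]_k | forall x, \sum_j laction (q 0 j) (f j) x = 0].
apply: (@generated_min P K) p => //.
apply: submodule_monomial => [x|u v Ku Kv x|c y u Ku x].
- by rewrite big1 // => j _; rewrite mxE laction0.
- rewrite (_ : \sum_j _ =
      \sum_j laction (u 0 j) (f j) x + \sum_j laction (v 0 j) (f j) x).
    by rewrite Ku Kv addr0.
  rewrite -big_split; apply: eq_bigr => j _ /=.
  by rewrite mxE -[u 0 j]scale1r laction_linear scale1r mul1r.
- rewrite (_ : \sum_j _ = c * \sum_j laction (u 0 j) (f j) (x + y)).
    by rewrite Ku mulr0.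
  rewrite mulr_sumr; apply: eq_bigr => j _.
  by rewrite mxE -scalerAl -[_ *: _]addr0 laction_linear laction_lmonomM laction0 addr0.
Qed.

(** A vector [v] of [Q] outside [P] is separated from [P] by a functional, which is then read as a
    trajectory in [system P] that [v] does not annihilate. *)
Lemma system_sub P Q : is_submodule P -> system P `<=` system Q -> Q `<=` P.
Proof.
move=> PM sPQ v Qv; apply: contrapT => Pv.
(* Row vectors carry scalars in [A]; finite functions present [A^k] as a vector space over [F]. *)
have rowD (c : F) (g h : {ffun 'I_k -> A}) :
    \row_j (c *: g + h) j = c%:A *: (\row_j g j) + \row_j h j.
  by apply/rowP => j; rewrite !mxE !ffunE -scalerAl mul1r.
pose toff u : {ffun 'I_k -> A} := [ffun j => u 0 j].
have toffK u : \row_j toff u j = u by apply/rowP => j; rewrite mxE ffunE.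
have [||| phi [phiL phiP phiv]] :=
    @separating_functional F _ [set g : {ffun 'I_k -> A} | P (\row_j g j)] (toff v).
- move=> c g h Pg Ph /=; rewrite rowD; apply: submoduleD => //; exact: submoduleZ.
- rewrite /= (_ : \row_j _ = 0); first exact: submodule0.
  by apply/rowP => j; rewrite !mxE ffunE.
- by rewrite /= toffK.
pose delta j (p : A) : {ffun 'I_k -> A} := [ffun i => if i == j then p else 0].
have deltaL j c p q : delta j (c *: p + q) = c *: delta j p + delta j q.
  by apply/ffunP => i; rewrite !ffunE; case: eqP => // _; rewrite scaler0 addr0.
have phi0 : phi 0 = 0.
  have /eqP := phiL 1 0 0; rewrite scaler0 addr0 mul1r -subr_eq subrr eq_sym.
  by move/eqP.
have phiD g h : phi (g + h) = phi g + phi h.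
  by have := phiL 1 g h; rewrite scale1r mul1r.
(* The trajectory records the values of [phi] on the monomial basis of [A^k]; [u] acting on it at
   [x] then gives [phi] of [u] times the monomial of [x]. *)
pose f j y := phi (delta j (lmonom F y)).
have delta0 j : delta j 0 = 0 by apply/ffunP => i; rewrite !ffunE if_same.
have fE j p x : laction p (f j) x = phi (delta j (lmonom F x * p)).
  move: p; apply: laurent_ind => [|c y p IH].
    by rewrite laction0 mulr0 delta0 phi0.
  by rewrite laction_linear IH laction_lmonom mulrDr -scalerAr lmonomM deltaL phiL.
have fsum u x : \sum_j laction (u 0 j) (f j) x = phi (toff (lmonom F x *: u)).
  under eq_bigr do rewrite fE.
  rewrite -(big_morph phi phiD phi0); congr phi.
  apply/ffunP => i; rewrite sum_ffunE !ffunE (bigD1 i) //= big1 => [|j ji].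
    by rewrite ffunE eqxx addr0 mxE.
  by rewrite ffunE eq_sym (negbTE ji).
have /sPQ/(_ v Qv 0) : system P f.
  by move=> u Pu x; rewrite fsum phiP //= toffK; exact: submoduleZ.
by rewrite fsum scale1r => /eqP; rewrite (negbTE phiv).
Qed.

Lemma system_inj P Q :
  is_submodule P -> is_submodule Q -> system P = system Q -> P = Q.
Proof. by move=> PM QM PQ; apply/seteqP; split; apply: system_sub => //; rewrite PQ. Qed.

(** * Sublattices, their subalgebras, and contraction *)

Lemma sublatticeP S :
  is_sublattice S <-> S 0 /\ forall x y, S x -> S y -> S (x - y).
Proof.
split=> [[S0 SB]|[S0 SB]].
  split=> [|x y Sx Sy]; first by move: S0; rewrite inE.
  by apply/set_mem; apply: SB; exact/mem_set.
by split=> [|x y /set_mem Sx /set_mem Sy]; apply/mem_set => //; exact: SB.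
Qed.

Lemma sublatticeN S x : is_sublattice S -> S x -> S (- x).
Proof. by move=> /sublatticeP[S0 SB] Sx; rewrite -sub0r; exact: SB. Qed.

Lemma sublatticeD S x y : is_sublattice S -> S x -> S y -> S (x + y).
Proof.
move=> SL Sx Sy; rewrite -[y]opprK; have /sublatticeP[_ SB] := SL.
by apply: SB => //; exact: sublatticeN.
Qed.

Lemma subalg_of0 S : subalg_of S (0 : A).
Proof. by apply/subalg_ofP => x; rewrite mcoeff0 eqxx. Qed.

Lemma subalg_of_linear S (c : F) (p q : A) :
  subalg_of S p -> subalg_of S q -> subalg_of S (c *: p + q).
Proof.
move=> /subalg_ofP Sp /subalg_ofP Sq; apply/subalg_ofP => x; rewrite lmcoeffD lmcoeffZ.
have [->|/Sp //] := eqVneq p@_x 0; rewrite mulr0 add0r; exact: Sq.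
Qed.

Lemma subalg_ofM S (p q : A) : is_sublattice S ->
  subalg_of S p -> subalg_of S q -> subalg_of S (p * q).
Proof.
move=> SL /subalg_ofP Sp /subalg_ofP Sq; rewrite (laurentZE p) mulr_suml.
rewrite big_seq; elim/big_rec: _ => [|x r xp Sr]; first exact: subalg_of0.
rewrite -scalerAl; apply: subalg_of_linear => //; apply/subalg_ofP => y.
rewrite mcoeff_lmonomM => /Sq Sy; rewrite -(subrK x y); apply: sublatticeD => //.
by apply: Sp; rewrite mcoeff_neq0.
Qed.

Lemma contraction_submodule S P : is_sublattice S -> is_submodule P ->
  is_submodule_over S (contraction S P).
Proof.
move=> SL PM; split=> [u []//||a u v Sa [Pu Su] [Pv Sv]].
  by split; [exact: submodule0 | move=> j; rewrite mxE; exact: subalg_of0].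
split; first by apply: submoduleD => //; exact: submoduleZ.
move=> j; rewrite !mxE -[a * _]scale1r; apply: subalg_of_linear => //.
exact: subalg_ofM.
Qed.

(** Equations with coefficients in [A_S] never relate points of different cosets of [S], so the
    system on [L] splits into copies of the system on [S]. *)
Lemma system_on_shift S Q (f : 'I_k -> L -> F) :
  is_sublattice S -> Q `<=` free_over S ->
  system Q f <->
  forall z, system_on S Q (fun j (s : {x | S x}) => f j (sval s + z)).
Proof.
move=> SL QS.
(* The support of [p] keeps [sval s + y] inside [S], so the default value of [extend0] is never
   read. *)
have fE z (p : A) j (s : {x | S x}) : subalg_of S p ->
    laction_on p (fun s : {x | S x} => f j (sval s + z)) s = laction p (f j) (sval s + z).
  move=> /subalg_ofP Sp; apply: eq_big_seq => y; rewrite -mcoeff_neq0 => /Sp Sy.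
  rewrite /extend0; case: pselect => [Sxy|]; first by rewrite /= addrAC.
  by case; apply: sublatticeD => //; exact: svalP.
split=> [sf z q Qq s|sf q Qq x].
  by apply: etrans (sf q Qq (sval s + z)); apply: eq_bigr => j _; apply: fE; exact: QS.
have S0 : S 0 by case/sublatticeP: SL.
(* The equation at [x] is the equation at the origin of [S] for the shift by [x]. *)
apply: etrans (sf x q Qq (exist _ 0 S0)); apply: eq_bigr => j _.
by rewrite fE /= ?add0r //; exact: QS.
Qed.

(** Whichever [Q] defines the contracted system, [system_on_shift] shows that [Q] and the
    contraction of [P] define the same system on [L]; duality turns this into an equality of
    modules. *)
Lemma reconstructibleP S P : is_sublattice S -> is_submodule P ->
  reconstructible P S <-> P = generated (contraction S P).
Proof.
move=> SL PM; have CM := contraction_submodule SL PM; split=> [[Q [[QS _ _] CQ PQ]]|PE].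
  apply: system_inj => //; first exact: generated_submodule.
  rewrite PQ !system_generated; have [CS _ _] := CM.
  by apply/seteqP; split=> f /system_on_shift fS; apply/(system_on_shift _ SL) => // z;
    [rewrite CQ|rewrite -CQ]; exact: fS.
by exists (contraction S P); split; rewrite -?PE.
Qed.

(** * Reconstruction as homogeneity for the grading by [Z^n / S] *)

Definition vrestr (d : set L) u : 'rV[A]_k := map_mx (restr d) u.

Lemma mcoeff_vrestr d u j x :
  (vrestr d u 0 j)@_x = if `[< d x >] then (u 0 j)@_x else 0.
Proof. by rewrite mxE mcoeff_restr. Qed.

Lemma vec_eq u v : (forall j x, (u 0 j)@_x = (v 0 j)@_x) -> u = v.
Proof. by move=> uv; apply/rowP => j; apply: laurent_eq. Qed.

(* [P] is homogeneous for the grading of [A^k] by [Z^n / S]. *)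
Definition graded S P : Prop :=
  forall z u, P u -> P (vrestr [set x | S (x - z)] u).

Lemma mcoeff_monomialM (c : F) x (p : A) y :
  ((c *: lmonom F x) * p)@_y = c * p@_(y - x).
Proof. by rewrite -scalerAl lmcoeffZ mcoeff_lmonomM. Qed.

(** A monomial is homogeneous, so it permutes the graded components. *)
Lemma vrestr_monomial (c : F) y z S u :
  vrestr [set x | S (x - z)] ((c *: lmonom F y) *: u) =
  (c *: lmonom F y) *: vrestr [set x | S (x - (z - y))] u.
Proof.
apply: vec_eq => j x.
rewrite mcoeff_vrestr [in RHS]mxE [in RHS]mcoeff_monomialM [in RHS]mcoeff_vrestr.
rewrite [in LHS]mxE [in LHS]mcoeff_monomialM /=.
by rewrite opprB addrA subrK; case: asboolP => // _; rewrite mulr0.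
Qed.

Lemma vrestrD d u v : vrestr d (u + v) = vrestr d u + vrestr d v.
Proof.
apply: vec_eq => j x; rewrite [in RHS]mxE [in RHS]lmcoeffD !mcoeff_vrestr mxE lmcoeffD.
by case: asboolP; rewrite ?addr0.
Qed.

Lemma free_over_vrestr S u z : is_sublattice S -> free_over S u ->
  vrestr [set x | S (x - z)] u = if `[< S z >] then u else 0.
Proof.
move=> SL Su; apply: vec_eq => j x; rewrite mcoeff_vrestr /=.
rewrite (fun_if (fun w : 'rV[A]_k => (w 0 j)@_x)).
rewrite mxE mcoeff0; have [->|ux] := eqVneq (u 0 j)@_x 0; first by rewrite !if_same.
have /subalg_ofP/(_ x ux) Sx := Su j; congr (if _ then _ else _).
apply: asbool_equiv_eq; split=> [Sxz|Sz].
  rewrite -(subKr x z); have /sublatticeP[_ SB] := SL; exact: SB.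
by have /sublatticeP[_ SB] := SL; exact: SB.
Qed.

(** The vectors all of whose components lie in [generated P] form a submodule. It contains [P],
    because a vector over [A_S] has only the component of the coset [S]. *)
Lemma generated_graded S P : is_sublattice S -> P `<=` free_over S ->
  graded S (generated P).
Proof.
move=> SL PS; have gM := generated_submodule P.
pose K := [set u | forall z, generated P (vrestr [set x | S (x - z)] u)].
suff sub : generated P `<=` K by move=> z u /sub.
have vrestr0 d : vrestr d 0 = 0.
  by apply: vec_eq => j x; rewrite mcoeff_vrestr mxE mcoeff0 if_same.
apply: generated_min.
  apply: submodule_monomial => [z|u v Ku Kv z|c y u Ku z].
  - by rewrite vrestr0; exact: submodule0.
  - by rewrite vrestrD; exact: (submoduleD gM (Ku _) (Kv _)).
  - by rewrite vrestr_monomial; exact: (submoduleZ _ gM (Ku _)).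
move=> u Pu z; rewrite free_over_vrestr //; last exact: PS.
by case: asboolP => _; [exact: generated_sub | exact: submodule0].
Qed.

Lemma finite_support u :
  exists s : seq L, forall j x, (u 0 j)@_x != 0 -> x \in s.
Proof.
exists (flatten [seq enum_fset (msupp (u 0 j)) | j <- enum 'I_k]) => j x.
rewrite mcoeff_neq0 => ux; apply/flattenP; exists (enum_fset (msupp (u 0 j))) => //.
by apply/mapP; exists j => //; rewrite mem_enum.
Qed.

(** A vector is the sum of finitely many components, and each is a monomial times a vector of [P]
    over [A_S]. *)
Lemma graded_generated S P : is_sublattice S -> is_submodule P ->
  graded S P -> P = generated (contraction S P).
Proof.
move=> SL PM gP; apply/seteqP; split; last by apply: generated_min => // u [].
have GM := generated_submodule (contraction S P).
have S0 : S 0 by case/sublatticeP: SL.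
have coset_part u z : P u -> generated (contraction S P) (vrestr [set x | S (x - z)] u).
  move=> Pu.
  (* The monomial of [- z] moves the coset of [z] onto [S]; its inverse moves it back. *)
  have zK : lmonom F z * lmonom F (- z) = 1 by rewrite lmonomM subrr.
  rewrite -[vrestr _ _]scale1r -zK -scalerA; apply: (submoduleZ _ GM).
  apply: generated_sub; split; first by apply: (submoduleZ _ PM); exact: gP.
  move=> j; apply/subalg_ofP => x; rewrite mxE mcoeff_lmonomM mcoeff_vrestr /=.
  by rewrite opprK addrK; case: asboolP => // _; rewrite eqxx.
move=> u Pu; have [s us] := finite_support u.
elim: s u Pu us => [|z s IH] u Pu us.
  suff -> : u = 0 by exact: submodule0.
  apply: vec_eq => j x; rewrite mxE mcoeff0.
  by apply/eqP; case: eqP => // /eqP /us.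
(* Removing the component of [z] clears its whole coset, so the tail [s] covers the remaining
   support. *)
rewrite -[u](subrK (vrestr [set x | S (x - z)] u)); apply: (submoduleD GM);
  last exact: coset_part.
apply: IH => [|j x]; first by apply: (submoduleB PM Pu); exact: gP.
rewrite mxE [X in (_ + X)@__]mxE mcoeffB mcoeff_vrestr /=; case: asboolP => [_|nS].
  by rewrite subrr eqxx.
rewrite subr0 => /us; rewrite inE => /orP[/eqP xz|//].
by case: nS; rewrite xz subrr.
Qed.

Lemma reconstructible_graded S P : is_sublattice S -> is_submodule P ->
  reconstructible P S <-> graded S P.
Proof.
move=> SL PM; split=> [/reconstructibleP -> //|gP].
  by apply: generated_graded => // u [].
by apply/reconstructibleP => //; exact: graded_generated.
Qed.

(** * The least sublattice whose grading [P] respects *)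

Definition least_lattice P : set L :=
  [set x | forall S, is_sublattice S -> graded S P -> S x].

Lemma least_lattice_sublattice P : is_sublattice (least_lattice P).
Proof.
apply/sublatticeP; split=> [S /sublatticeP[]//|x y Sx Sy S SL gS].
by have /sublatticeP[_ SB] := SL; apply: SB; [exact: Sx|exact: Sy].
Qed.

(* A vector has finite support, so finitely many of the lattices being
   intersected already cut it into the same homogeneous components. *)
Lemma least_lattice_graded P : graded (least_lattice P) P.
Proof.
move=> z u Pu.
(* Here [d] is a finite intersection of cosets [z + T], with one grading sublattice [T] for each
   point of [s] outside the coset of [z] modulo [least_lattice P]. *)
have sep (s : seq L) : exists d : set L,
    [/\ forall v, P v -> P (vrestr d v),
        forall x, least_lattice P (x - z) -> d x &
        forall x, x \in s -> d x -> least_lattice P (x - z)].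
  elim: s => [|y s [d [Pd Sd ds]]].
    exists setT; split=> // v Pv; suff -> : vrestr setT v = v by [].
    by apply: vec_eq => j x; rewrite mcoeff_vrestr; case: asboolP => // -[].
  have [Sy|/existsNP[T /not_implyP[TL /not_implyP[gT Ty]]]]
    := pselect (least_lattice P (y - z)).
    exists d; split=> // x; rewrite inE => /orP[/eqP -> //|]; exact: ds.
  exists (d `&` [set x | T (x - z)]); split=> [v Pv|x Sx|x].
  - suff -> : vrestr (d `&` [set x | T (x - z)]) v =
      vrestr [set x | T (x - z)] (vrestr d v).
      by apply: gT; exact: Pd.
    apply: vec_eq => j x; rewrite !mcoeff_vrestr asbool_and.
    by case: asboolP; case: asboolP.
  - by split; [exact: Sd | exact: Sx].
  - by rewrite inE => /orP[/eqP -> []//|xs [dx _]]; exact: ds.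
have [s us] := finite_support u; have [d [Pd Sd ds]] := sep s.
suff -> : vrestr [set x | least_lattice P (x - z)] u = vrestr d u by exact: Pd.
apply: vec_eq => j x; rewrite !mcoeff_vrestr.
have [->|ux] := eqVneq (u 0 j)@_x 0; first by rewrite !if_same.
congr (if _ then _ else _); apply: asbool_equiv_eq; split; first exact: Sd.
by apply: ds; exact: us ux.
Qed.

(** * Constant submodules, the zero sublattice and rank *)

Lemma free_over0 u : free_over [set 0] u <-> exists g : 'rV[F]_k, u = map_mx (in_alg A) g.
Proof.
split=> [u0|[g ->] j]; last first.
  by apply/subalg_ofP => x; rewrite mxE mcoeff_in_alg; have [->|_] := eqVneq x 0;
    rewrite ?mulr0n ?eqxx.
exists (\row_j (u 0 j)@_0); apply: vec_eq => j x; rewrite !mxE mcoeff_in_alg.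
case: (eqVneq x 0) => [-> //|/eqP x0]; have /subalg_ofP/(_ x) ux := u0 j.
by apply/eqP; apply: contrapT => /negP /ux.
Qed.

(** Every sublattice contains [0], so constant generators already lie in the contraction. *)
Lemma constant_reconstructible S P : is_sublattice S -> is_submodule P ->
  is_constant P -> reconstructible P S.
Proof.
move=> SL PM [G PE]; apply/reconstructibleP => //; apply/seteqP; split; last first.
  by apply: generated_min => // u [].
rewrite {1}PE; apply: generated_min; first exact: generated_submodule.
move=> u Gu; apply: generated_sub; split; first by rewrite PE; exact: generated_sub.
have /free_over0 u0 : exists g : 'rV[F]_k, u = map_mx (in_alg A) g.
  by case: Gu => g _ <-; exists g.
move=> j; apply/subalg_ofP => x; have /subalg_ofP/(_ x) := u0 j; move=> /[apply] ->.
by case/sublatticeP: SL.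
Qed.

Lemma reconstructible0_constant P :
  P = generated (contraction [set 0] P) -> is_constant P.
Proof.
move=> PE; exists [set g | P (map_mx (in_alg A) g)].
rewrite {1}PE; congr generated; apply/seteqP.
split=> [u [Pu /free_over0[g ug]]|u [g Pg <-]].
  by exists g; rewrite /= -?ug.
by split => //; apply/free_over0; exists g.
Qed.

(** The one-row matrix [x] is a witness for rank 1, since the integers have no zero divisors;
    [0 < n] makes 1 an index of the maximum. *)
Lemma lattice_rank_gt0 S x :
  (0 < n)%N -> S x -> x != 0 -> (0 < lattice_rank S)%N.
Proof.
move=> n0 Sx x0.
have n1 : (1 < n.+1)%N by [].
rewrite /lattice_rank (bigD1 (Ordinal n1)) /=; first exact: leq_maxl.
apply/asboolP; exists x; split=> [i|u ux].
  by rewrite (_ : row i x = x) //; apply/rowP => j; rewrite mxE ord1.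
apply/rowP => i; rewrite ord1 mxE; apply/eqP; apply: contraNT x0 => u0.
apply/eqP/rowP => j; move/rowP/(_ j): ux; rewrite !mxE big_ord1 => /eqP.
by rewrite mulf_eq0 (negbTE u0) => /eqP.
Qed.

End Submodules.

Theorem theorem6p1 (F : closedFieldType)
    (hF : is_complex_field F \/ has_pos_char F)
    (n k : nat) (hn : (0 < n)%N) (hk : (0 < k)%N)
    (P : set 'rV[laurent n F]_k) (hP : is_submodule P) :
  (is_constant P ->
     (forall S : set 'rV[int]_n, is_sublattice S -> reconstructible P S) /\
     reconstructible P [set 0]) /\
  (~ is_constant P ->
     exists S : set 'rV[int]_n,
       [/\ coarsest_reconstructible P S,
           forall S' : set 'rV[int]_n,
             coarsest_reconstructible P S' -> S' = S &
           (1 <= lattice_rank S)%N]).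
Proof.
have L0 : is_sublattice [set 0 : 'rV[int]_n].
  by apply/sublatticeP; split=> // x y -> ->; rewrite /= subrr.
split=> [Pc|Pc]; first by split=> [S SL|]; exact: constant_reconstructible.
pose S0 := least_lattice P.
have S0L : is_sublattice S0 by exact: least_lattice_sublattice.
have S0R : reconstructible P S0.
  by apply/reconstructible_graded => //; exact: least_lattice_graded.
have S0min S : is_sublattice S -> reconstructible P S -> S0 `<=` S.
  by move=> SL /reconstructible_graded gS x; apply => //; exact: gS.
exists S0; split.
- by split=> // S SL [_ SS0] SR; apply: SS0; exact: S0min.
(* [S0] lies in [S]; if it were strictly smaller, it would contradict the minimality of [S]. *)
- move=> S [SL SR Smin]; apply/seteqP; split; last exact: S0min.
  by apply: contrapT => nSS0; apply: (Smin S0) => //; split=> //; exact: S0min.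
(* Otherwise [S0] is the zero sublattice, and reconstruction from it makes [P] constant. *)
- have [x S0x x0] : exists2 x, S0 x & x != 0.
    apply: contrapT => nx; apply: Pc; apply: reconstructible0_constant => //.
    apply/reconstructibleP => //; suff <- : S0 = [set 0] by [].
    apply/seteqP; split=> [x S0x|x ->]; last by case/sublatticeP: S0L.
    by apply: contrapT => /eqP x0; apply: nx; exists x.
  exact: lattice_rank_gt0 S0x x0.
Qed.
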